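(* Let $k\ge2$ and $r\ge 2$ be integers and let $q=\frac{r^k-1}{r-1}$. Every $k$-uniform hypergraph $G$ with $m$ edges contains a subhypergraph with at least $\frac{1}{2\,k!}m^{(q-1)/q}$ edges which contains no copy of $K^{(k)}_{r,\ldots,r}$.
   Context: $K^{(k)}_{r,\ldots,r}$ denotes the complete $k$-partite $k$-uniform hypergraph with $k$ parts each of order $r$ (its edges are all $k$-sets containing exactly one vertex from each part). *)

(* Defs.v *)
From mathcomp Require Import all_boot.

Set Implicit Arguments.
Unset Strict Implicit.
Unset Printing Implicit Defensive.

(* V is only an ambient type: the vertex set is the explicit subset [verts],
   so that a subhypergraph may drop vertices as well as edges. *)
Record hypergraph (V : finType) := Hypergraph {
  verts : {set V};
  edges : {set {set V}};
  edges_sub : forall e, e \in edges -> e \subset verts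
}.

Definition uniform (V : finType) (k : nat) (G : hypergraph V) : Prop :=
  forall e, e \in edges G -> #|e| = k.

Definition subhypergraph (V : finType) (H G : hypergraph V) : Prop :=
  verts H \subset verts G /\ edges H \subset edges G.

(* Copies are not required to be induced. *)
Definition contains_copy (U V : finType) (K : hypergraph U) (G : hypergraph V)
    : Prop :=
  exists f : U -> V,
    [/\ {in verts K &, injective f},
        f @: verts K \subset verts G &
        forall e, e \in edges K -> f @: e \in edges G].

Section CompleteKPartite.
Variables k r : nat.

(* The vertex (i, j) is the j-th vertex of the i-th part. *)
Definition part (i : 'I_k) : {set 'I_k * 'I_r} := [set v | v.1 == i].

Definition complete_kpartite_edges : {set {set 'I_k * 'I_r}} :=
  [set e : {set 'I_k * 'I_r} | (#|e| == k) && [forall i, #|e :&: part i| == 1]].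

Lemma complete_kpartite_sub e :
  e \in complete_kpartite_edges -> e \subset [set: 'I_k * 'I_r].
Proof. by move=> _; apply: subsetT. Qed.

Definition complete_kpartite : hypergraph ('I_k * 'I_r)%type :=
  Hypergraph complete_kpartite_sub.

End CompleteKPartite.

(* Main.v *)
Require Import Defs.
From mathcomp Require Import all_boot all_order all_algebra.
From mathcomp Require Import reals exp zify ring lra.

Set Implicit Arguments.
Unset Strict Implicit.
Unset Printing Implicit Defensive.

Import Order.TTheory GRing.Theory Num.Theory.
Local Open Scope ring_scope.

(** Deletion method. Choose every edge of [G] independently with probability
    [p = m^(-1/q) / k!] and delete one edge from each surviving copy of
    [K_(r,...,r)]. The [r] disjoint edges [{f (i, j) | i}] determine a labelled
    copy [f], so there are at most [(m k!)^r] of them, each with [r^k] edges;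
    since [r^k = q (r - 1) + 1], the expected number [p^(r^k) (m k!)^r] of
    surviving copies is at most half the expected number [p m] of chosen
    edges. *)

Lemma exists_ge_weighted_mean (R : realDomainType) (T : finType)
    (w X : T -> R) :
  (forall x, 0 <= w x) -> \sum_x w x = 1 ->
  exists x, \sum_y w y * X y <= X x.
Proof.
move=> w_ge0 w_sum1; have [x0 _|T0] := pickP (@predT T); last first.
  by have /eqP := w_sum1; rewrite big_pred0 // eq_sym oner_eq0.
have [x _ X_max] := @arg_maxP _ _ _ x0 predT X isT; exists x.
rewrite -[leRHS]mul1r -w_sum1 mulr_suml.
by apply: ler_sum => y _; rewrite ler_wpM2l //; apply: X_max.
Qed.

Section BernoulliWeight.
Variable T : finType.

Definition bernoulli_weight (R : pzRingType) (p : R) (S : {set T}) : R :=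
  \prod_x (if x \in S then p else 1 - p).

Lemma bernoulli_weight_ge0 (R : numDomainType) (p : R) S :
  0 <= p <= 1 -> 0 <= bernoulli_weight p S.
Proof.
case/andP=> p0 p1; apply: prodr_ge0 => x _.
by case: ifP => // _; rewrite subr_ge0.
Qed.

Variables (R : comPzRingType) (p : R).

Lemma sum_bernoulli_weight_supersets (D : {set T}) :
  \sum_(S : {set T} | D \subset S) bernoulli_weight p S = p ^+ #|D|.
Proof.
have -> : p ^+ #|D| = \prod_x (p + (if x \in D then 0 else 1 - p)).
  rewrite -prodr_const [RHS](bigID (mem D)) /= [X in _ = _ * X]big1 ?mulr1.
    by apply: eq_bigr => x ->; rewrite addr0.
  by move=> x /negPf->; rewrite addrC subrK.
rewrite bigA_distr big_mkcond; apply: eq_bigr => S _.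
case: ifPn => [DS|/subsetPn[x xD xS]].
  apply: eq_bigr => x _; case: ifPn => // xS.
  by rewrite (contraNF (subsetP DS x)).
by rewrite (bigD1 x) //= (negPf xS) xD mul0r.
Qed.

Lemma sum_bernoulli_weight : \sum_(S : {set T}) bernoulli_weight p S = 1.
Proof.
rewrite -[RHS](expr0 p) -(cards0 T) -sum_bernoulli_weight_supersets.
by apply: eq_bigl => S; rewrite sub0set.
Qed.

Lemma mean_card_contained (I : finType) (A : {set I}) (B : I -> {set T}) :
  \sum_S bernoulli_weight p S * #|[set i in A | B i \subset S]|%:R =
  \sum_(i in A) p ^+ #|B i|.
Proof.
under [RHS]eq_bigr do rewrite -sum_bernoulli_weight_supersets big_mkcond.
rewrite exchange_big /=; apply: eq_bigr => S _.
rewrite -big_mkcondr sumr_const -[RHS]mulr_natr; congr (_ * _%:R).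
by apply: eq_card => i; rewrite inE.
Qed.

Lemma mean_card_setI (E : {set T}) :
  \sum_S bernoulli_weight p S * #|S :&: E|%:R = p * #|E|%:R.
Proof.
rewrite mulr_natr -sumr_const.
transitivity (\sum_(x in E) p ^+ #|[set x]|); last first.
  by apply: eq_bigr => x _; rewrite cards1.
rewrite -mean_card_contained; apply: eq_bigr => S _; congr (_ * _%:R).
by apply: eq_card => x; rewrite !inE sub1set andbC.
Qed.

End BernoulliWeight.

Section AvoidingSubsets.
Variables (T I : finType) (B : I -> {set T}).

Lemma exists_small_hitting_set (P : {set I}) :
  {in P, forall i, B i != set0} ->
  exists2 D : {set T}, {in P, forall i, ~~ [disjoint B i & D]}
    & (#|D| <= #|P|)%N.
Proof.
have [->|[i0 i0P] B_neq0] := set_0Vmem P.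
  by exists set0 => [i|]; rewrite ?inE ?cards0.
have /set0Pn[x0 _] := B_neq0 i0 i0P; pose pt i := odflt x0 [pick x in B i].
exists (pt @: P); last exact: leq_imset_card.
move=> i iP; apply/pred0Pn; exists (pt i); rewrite /= imset_f // andbT /pt.
by case: pickP => // B0; have /set0Pn[x] := B_neq0 i iP; rewrite B0.
Qed.

Lemma exists_large_avoiding_subset (R : realDomainType) (p : R) (E : {set T})
    (P : {set I}) :
  0 <= p <= 1 -> {in P, forall i, B i != set0} ->
  exists S : {set T},
    [/\ S \subset E,
        {in P, forall i, ~~ (B i \subset S)} &
        p * #|E|%:R - \sum_(i in P) p ^+ #|B i| <= #|S|%:R].
Proof.
move=> p01 B_neq0; pose bad (S : {set T}) := [set i in P | B i \subset S].
have [S] := exists_ge_weighted_mean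
  (fun S : {set T} => #|S :&: E|%:R - #|bad S|%:R)
  (fun S => bernoulli_weight_ge0 S p01) (sum_bernoulli_weight T p).
under eq_bigr do rewrite mulrBr.
rewrite sumrB mean_card_setI mean_card_contained => mean_le.
have bad_neq0 : {in bad S, forall i, B i != set0} by move=> i /setIdP[/B_neq0].
have [D D_hits D_small] := exists_small_hitting_set bad_neq0.
exists ((S :&: E) :\: D); split.
- by rewrite subDset subsetU // subsetIr orbT.
- move=> i iP; apply/negP; rewrite subsetD subsetI => /andP[/andP[BS _]].
  by apply/negP/D_hits; rewrite inE iP.
apply: le_trans mean_le _; rewrite lerBlDr -natrD ler_nat.
rewrite -(cardsID D (S :&: E)) addnC leq_add2l.
by apply: leq_trans D_small; rewrite subset_leq_card // subsetIr.
Qed.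

End AvoidingSubsets.

Lemma imset_inj_in (aT rT : finType) (f : aT -> rT) (D : {set aT}) :
  {in D &, injective f} ->
  {in [pred A : {set aT} | A \subset D] &,
    injective (fun A : {set aT} => f @: A)}.
Proof.
move=> f_inj A A' /= AD A'D fAA'.
suff subI (C C' : {set aT}) :
    C \subset D -> C' \subset D -> f @: C = f @: C' -> C \subset C'.
  by apply/eqP; rewrite eqEsubset (subI A A') ?(subI A' A).
move=> /subsetP CD /subsetP C'D fCC'; apply/subsetP => x xC.
have: f x \in f @: C' by rewrite -fCC' imset_f.
by case/imsetP => y yC' /f_inj ->; [|exact: CD|exact: C'D].
Qed.

Section Copies.
Variables U V : finType.
Implicit Types (K : hypergraph U) (G H : hypergraph V) (f : {ffun U -> V}).

Definition copy_edges K f : {set {set V}} :=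
  [set f @: e | e : {set U} in edges K].

(* Values of [f] outside [verts K] are unconstrained, so copies are overcounted
   unless [verts K] is the whole type. *)
Definition copies K G : {set {ffun U -> V}} :=
  [set f : {ffun U -> V} | [&& dinjectiveb f (verts K),
    f @: verts K \subset verts G & copy_edges K f \subset edges G]].

Lemma contains_copyP K G : reflect (contains_copy K G) (copies K G != set0).
Proof.
apply: (iffP (set0Pn _)) => [[f]|[f [f_inj fV fE]]].
  rewrite inE => /and3P[/dinjectiveP f_inj fV /subsetP fE].
  by exists f; split=> // e eK; apply/fE/imset_f.
exists (finfun f); rewrite inE (eq_imset _ (ffunE _)) fV /=; apply/andP; split.
  by apply/dinjectiveP => u v uK vK; rewrite !ffunE; apply: f_inj.
by apply/subsetP => _ /imsetP[e /fE fe ->]; rewrite (eq_imset _ (ffunE _)).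
Qed.

Lemma copiesS K G H : subhypergraph H G -> copies K H \subset copies K G.
Proof.
case=> HGv HGe; apply/subsetP => f; rewrite !inE => /and3P[-> fV fE] /=.
by rewrite (subset_trans fV) ?(subset_trans fE).
Qed.

Lemma card_copy_edges K G f :
  f \in copies K G -> #|copy_edges K f| = #|edges K|.
Proof.
rewrite inE => /and3P[/dinjectiveP f_inj _ _]; apply: card_in_imset.
by move=> e e' /edges_sub eK /edges_sub e'K; apply: (imset_inj_in f_inj).
Qed.

Lemma exists_copy_free_subhypergraph (R : realDomainType) (p : R) K G :
  0 <= p <= 1 -> edges K != set0 ->
  exists H : hypergraph V,
    [/\ subhypergraph H G,
        p * #|edges G|%:R - p ^+ #|edges K| * #|copies K G|%:R
          <= #|edges H|%:R &
        ~ contains_copy K H].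
Proof.
move=> p01 K_neq0.
have copy_neq0 : {in copies K G, forall f, copy_edges K f != set0}.
  by move=> f /card_copy_edges cardK; rewrite -card_gt0 cardK card_gt0.
have [S [SG S_free S_large]] :=
  exists_large_avoiding_subset (edges G) p01 copy_neq0.
have S_verts e : e \in S -> e \subset verts G.
  by move=> eS; apply: edges_sub; apply: (subsetP SG).
have HG : subhypergraph (Hypergraph S_verts) G by split.
exists (Hypergraph S_verts); split=> //=.
  apply: le_trans S_large; rewrite lerD2l lerN2 mulr_natr -sumr_const.
  by apply: ler_sum => f /card_copy_edges ->.
move=> /contains_copyP/set0Pn[f fH]; have := subsetP (copiesS K HG) f fH.
by move=> /S_free/negP; apply; move: fH; rewrite inE => /and3P[].
Qed.

End Copies.

Section CompleteKPartiteCopies.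
Variables k r : nat.

Definition transversal (g : {ffun 'I_k -> 'I_r}) : {set 'I_k * 'I_r} :=
  [set (i, g i) | i : 'I_k].

Lemma mem_transversal g i j : ((i, j) \in transversal g) = (j == g i).
Proof. by apply/imsetP/eqP => [[i' _ [-> ->]]|->] //; exists i. Qed.

Lemma transversal_inj : injective transversal.
Proof.
move=> g h gh; apply/ffunP => i; apply/eqP.
by rewrite -mem_transversal -gh mem_transversal.
Qed.

Lemma edges_complete_kpartiteE :
  edges (complete_kpartite k r) = [set transversal g | g : {ffun 'I_k -> 'I_r}].
Proof.
apply/setP => e; rewrite inE.
apply/andP/imsetP => [[_ /forallP e_part]|[g _ ->]].
  have /fin_all_exists[g gP] (i : 'I_k) :
      exists j : 'I_r, e :&: part r i = [set (i, j)].
    have /cards1P[[i' j] eij] := e_part i; exists j; rewrite eij.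
    have : (i', j) \in e :&: part r i by rewrite eij set11.
    by rewrite !inE => /andP[_ /eqP/= ->].
  exists (finfun g) => //; apply/setP => -[i j]; rewrite mem_transversal ffunE.
  have /setP/(_ (i, j)) := gP i.
  by rewrite !inE xpair_eqE /= eqxx andbT.
rewrite card_imset ?card_ord => [|i i' []] //; split=> //.
apply/forallP => i; apply/cards1P; exists (i, g i); apply/setP => -[i' j].
rewrite in_setI mem_transversal !inE /= xpair_eqE andbC.
by case: eqP => // ->.
Qed.

Lemma card_edges_complete_kpartite :
  #|edges (complete_kpartite k r)| = (r ^ k)%N.
Proof.
rewrite edges_complete_kpartiteE card_imset; last exact: transversal_inj.
by rewrite card_ffun !card_ord.
Qed.

Variables (V : finType) (G : hypergraph V).

Definition ordered_edges : {set {ffun 'I_k -> V}} :=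
  [set h : {ffun 'I_k -> V} | injectiveb h & [set h i | i : 'I_k] \in edges G].

Lemma card_ordered_edges :
  uniform k G -> #|ordered_edges| = (#|edges G| * k`!)%N.
Proof.
move=> Gk; pose range (h : {ffun 'I_k -> V}) := [set h i | i : 'I_k].
rewrite -sum1_card (partition_big range (mem (edges G))) /=; last first.
  by move=> h; rewrite inE => /andP[].
rewrite -sum_nat_const; apply: eq_bigr => e eG; have ek := Gk e eG.
have range_eq (h : {ffun 'I_k -> V}) :
      injective h -> (range h == e) = (h \in ffun_on (mem e)).
  move=> h_inj; rewrite eqEcard card_imset // card_ord ek leqnn andbT.
  apply/subsetP/ffun_onP => [range_sub i|he _ /imsetP[i _ ->]] //.
  exact/range_sub/imset_f.
rewrite sum1dep_card.
transitivity #|[set h in ffun_on (mem e) | injectiveb (h : {ffun 'I_k -> V})]|;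
  last by rewrite card_inj_ffuns_on ek card_ord ffactnn.
apply: eq_card => h.
rewrite [LHS]inE [X in X && _]inE [RHS]inE [RHS]andbC -andbA.
case: injectiveP => //= /range_eq <-.
by rewrite andb_idl // => /eqP range_h; rewrite -/(range h) range_h.
Qed.

Definition column (f : {ffun 'I_k * 'I_r -> V}) :
    {ffun 'I_r -> {ffun 'I_k -> V}} :=
  [ffun j => [ffun i => f (i, j)]].

Lemma column_inj : injective column.
Proof.
move=> f f' /ffunP cols; apply/ffunP => -[i j].
by have := cols j; rewrite !ffunE => /ffunP/(_ i); rewrite !ffunE.
Qed.

Lemma column_ordered_edges f j :
  f \in copies (complete_kpartite k r) G -> column f j \in ordered_edges.
Proof.
rewrite inE => /and3P[/dinjectiveP f_inj _ /subsetP fG]; rewrite inE !ffunE.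
apply/andP; split.
  apply/injectiveP => i i'; rewrite !ffunE => /f_inj.
  by rewrite !inE => /(_ isT isT)[].
have -> : [set [ffun i => f (i, j)] i | i : 'I_k] = f @: transversal [ffun=> j].
  by rewrite -imset_comp; apply: eq_imset => i; rewrite /= !ffunE.
by apply/fG/imset_f; rewrite edges_complete_kpartiteE imset_f.
Qed.

Lemma card_copies_complete_kpartite :
  uniform k G ->
  (#|copies (complete_kpartite k r) G| <= (#|edges G| * k`!) ^ r)%N.
Proof.
move=> /card_ordered_edges <-; rewrite -(card_imset _ column_inj).
rewrite -[in leqRHS](card_ord r) -card_ffun_on; apply/subset_leq_card/subsetP.
move=> _ /imsetP[f f_copy ->]; apply/ffun_onP => j.
exact: column_ordered_edges.
Qed.

End CompleteKPartiteCopies.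

Lemma exists_complete_kpartite_free_subhypergraph (R : realDomainType) (p : R)
    (k r : nat) (V : finType) (G : hypergraph V) :
  0 <= p <= 1 -> (0 < r)%N -> uniform k G ->
  exists H : hypergraph V,
    [/\ subhypergraph H G,
        p * #|edges G|%:R - p ^+ (r ^ k) * (#|edges G|%:R * k`!%:R) ^+ r
          <= #|edges H|%:R &
        ~ contains_copy (complete_kpartite k r) H].
Proof.
move=> p01 r_gt0 Gk; have /andP[p_ge0 _] := p01.
have K_neq0 : edges (complete_kpartite k r) != set0.
  by rewrite -card_gt0 card_edges_complete_kpartite expn_gt0 r_gt0.
have [H [HG H_large H_free]] := exists_copy_free_subhypergraph G p01 K_neq0.
exists H; split=> //; apply: le_trans H_large.
rewrite card_edges_complete_kpartite lerD2l lerN2 ler_wpM2l ?exprn_ge0 //.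
by rewrite -natrM -natrX ler_nat card_copies_complete_kpartite.
Qed.

Lemma deletion_gain_ge_half (F : realFieldType) (p M c : F) (n r : nat) :
  0 <= p -> 0 <= M -> 2 <= c -> (p * c) ^+ n * M <= 1 -> (r < n * r.-1)%N ->
  p * M / 2 <= p * M - p ^+ (n * r.-1).+1 * (M * c) ^+ r.
Proof.
move=> p_ge0 M_ge0 c_ge2 pcM_le1; case: r => [|s] /= s_lt.
  by rewrite muln0 in s_lt.
have c_ge1 : 1 <= c by lra.
pose t := (p ^+ n * M) ^+ s.
have -> : p ^+ (n * s).+1 * (M * c) ^+ s.+1 = p * M * (t * c ^+ s.+1).
  by rewrite /t !exprMn !exprS exprM; ring.
have t_ge0 : 0 <= t by rewrite exprn_ge0 // mulr_ge0 ?exprn_ge0.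
have tc_le1 : t * c ^+ (n * s) <= 1.
  rewrite exprM -exprMn mulrAC -exprMn exprn_ile1 // mulr_ge0 ?exprn_ge0 //.
  by rewrite mulr_ge0 //; lra.
have c_growth : c ^+ s.+1 * 2 <= c ^+ (n * s).
  apply: le_trans (ler_weXn2l c_ge1 s_lt).
  by rewrite [leRHS]exprSr ler_wpM2l ?exprn_ge0 //; lra.
have loss_le : t * c ^+ s.+1 * 2 <= 1.
  by apply: le_trans tc_le1; rewrite -mulrA ler_wpM2l.
rewrite -[X in _ <= X - _]mulr1 -mulrBr ler_wpM2l ?mulr_ge0 //; lra.
Qed.

Lemma expn_geometric_sum (r k : nat) :
  (0 < r)%N -> (r ^ k = ((\sum_(i < k) r ^ i) * r.-1).+1)%N.
Proof. by move=> r_gt0; rewrite mulnC -predn_exp prednK // expn_gt0 r_gt0. Qed.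

Lemma natr_geometric_quotient (F : numFieldType) (r k : nat) :
  (1 < r)%N ->
  (r%:R ^+ k - 1) / (r%:R - 1) = (\sum_(i < k) r ^ i)%:R :> F.
Proof.
move=> r_gt1; have r_neq1 : r%:R - 1 != 0 :> F.
  by rewrite subr_eq0 pnatr_eq1 gtn_eqF.
rewrite subrX1 mulrAC divff // mul1r natr_sum.
by apply: eq_bigr => i _; rewrite natrX.
Qed.

Section RealPowers.
Variable R : realType.

Lemma natr_powRN_le1 (m : nat) (a : R) : 0 < a -> m%:R `^ (- a) <= 1.
Proof.
move=> a_gt0; have [->|m_gt0] := posnP m.
  by rewrite powR0 ?ler01 // oppr_eq0 gt_eqF.
by rewrite -[leRHS](powRr0 m%:R) ler_powR ?ler1n // oppr_le0 ltW.
Qed.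

Lemma powRNV_exp_mul_le1 (x : R) (n : nat) :
  0 <= x -> (0 < n)%N -> (x `^ (- n%:R^-1)) ^+ n * x <= 1.
Proof.
move=> x_ge0 n_gt0.
rewrite -powR_mulrn ?powR_ge0 // -powRrM mulNr mulVf ?pnatr_eq0 -?lt0n //.
rewrite powR_inv1 //; have [->|x_neq0] := eqVneq x 0; first by rewrite mulr0.
by rewrite mulVf.
Qed.

Lemma powR_subr1_div (x q : R) :
  0 <= x -> 1 < q -> x `^ ((q - 1) / q) = x * x `^ (- q^-1).
Proof.
move=> x_ge0 q_gt1; have q_gt0 : 0 < q by lra.
rewrite -mulr_powRB1 // ?divr_gt0 ?subr_gt0 //; congr (_ * _ `^ _).
by field; rewrite gt_eqF.
Qed.

End RealPowers.

Theorem theorem3p4 (R : realType) (k r : nat) (hk : (2 <= k)%N) (hr : (2 <= r)%N)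
    (q : R) (hq : q = (r%:R ^+ k - 1) / (r%:R - 1))
    (V : finType) (G : hypergraph V) (hG : uniform k G)
    (m : nat) (hm : #|edges G| = m) :
  exists H : hypergraph V,
    [/\ subhypergraph H G,
        1 / (2 * k`!%:R) * (m%:R `^ ((q - 1) / q)) <= #|edges H|%:R :> R &
        ~ contains_copy (complete_kpartite k r) H].
Proof.
pose Q := (\sum_(i < k) r ^ i)%N; have rk := expn_geometric_sum k (ltnW hr).
have qE : q = Q%:R by rewrite hq natr_geometric_quotient.
have r2 : (r ^ 2 <= r ^ k)%N by rewrite leq_exp2l.
have Q_large : (r < Q * r.-1)%N by rewrite -ltnS -rk; nia.
have Q_gt1 : (1 < Q)%N by nia.
have q_gt1 : 1 < q by rewrite qE ltr1n.
pose c : R := k`!%:R; pose p : R := m%:R `^ (- q^-1) / c.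
have c_ge2 : 2 <= c by rewrite ler_nat (leq_trans hk) ?fact_geq.
have p_ge0 : 0 <= p by rewrite divr_ge0 ?powR_ge0.
have p01 : 0 <= p <= 1.
  rewrite p_ge0 ler_pdivrMr ?mul1r; last by lra.
  by apply: le_trans (natr_powRN_le1 m _) _; rewrite ?invr_gt0; lra.
have [H [HG H_large H_free]] :=
  exists_complete_kpartite_free_subhypergraph p01 (ltnW hr) hG.
exists H; split=> //; apply: le_trans H_large.
have -> : 1 / (2 * c) * m%:R `^ ((q - 1) / q) = p * m%:R / 2.
  by rewrite powR_subr1_div // /p; field; rewrite gt_eqF //; lra.
rewrite hm rk; apply: deletion_gain_ge_half => //.
rewrite /p divfK; last by rewrite gt_eqF //; lra.
by rewrite qE powRNV_exp_mul_le1 // ltnW.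
Qed.
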